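(* Let $\{X_n,n\geq1\}$ be a $\varphi$-mixing sequence of random variables with common marginal distribution function $F$, whose mixing coefficients satisfy $\sum_{n=1}^\infty\varphi^{1/2}(n)<\infty$. Fix $p\in(0,1)$ and let $\xi_p=\inf\{x:F(x)\geq p\}$. Assume that $F$ possesses a positive continuous density $f$ in a neighborhood $\mathscr{N}_p$ of $\xi_p$ such that $0<d=\sup\{f(x):x\in\mathscr{N}_p\}<\infty$. Let $C_3=4\big[1+4\sum_{n=1}^\infty\varphi^{1/2}(n)\big]$. For any $\theta>0$ put $$\tau_n=\frac{\sqrt{16C_3+\theta}\,(\log n)^{3/2}}{n^{1/2}(\log\log n)^{1/2}},\qquad \mathscr{E}_n=[\xi_p-\tau_n,\xi_p+\tau_n].$$ Then with probability 1, $$\sup_{x\in\mathscr{E}_n}|F_n(x)-F(x)|\leq(1+d)\left(\frac{(16C_3+\theta)\log n}{4n}\right)^{1/2}\quad\text{for all } n\text{ sufficiently large}.$$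
   Context: All random variables are defined on a probability space $(\Omega,\mathcal{F},P)$. $F_n(x)=\frac1n\sum_{i=1}^n I(X_i\leq x)$ is the empirical distribution function of $X_1,\dots,X_n$. For $n\leq m$ let $\mathcal{F}_n^m=\sigma(X_i,n\leq i\leq m)$. For sub-$\sigma$-algebras $\mathcal{B},\mathcal{R}$ let $\varphi(\mathcal{B},\mathcal{R})=\sup_{A\in\mathcal{B},B\in\mathcal{R},P(A)>0}|P(B\mid A)-P(B)|$, and the mixing coefficients are $\varphi(n)=\sup_{k\geq1}\varphi(\mathcal{F}_1^k,\mathcal{F}_{k+n}^\infty)$. The sequence is called $\varphi$-mixing if $\varphi(n)\downarrow0$ as $n\to\infty$. *)

(* Defs.v *)
From HB Require Import structures.
From mathcomp Require Import all_boot all_order all_algebra.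
From mathcomp Require Import all_classical all_reals all_analysis.
Set Implicit Arguments. Unset Strict Implicit. Unset Printing Implicit Defensive.
Import Order.TTheory GRing.Theory Num.Theory.
Import numFieldNormedType.Exports.
Local Open Scope classical_set_scope.
Local Open Scope ring_scope.

Definition gen_sigma {d} {T : measurableType d} {R : realType}
  (X : nat -> T -> R) (I : set nat) : set (set T) :=
  <<s \bigcup_(i in I) [set X i @^-1` B | B in [set B : set R | measurable B]] >>.

Definition phi_values {d} {T : measurableType d} {R : realType}
  (P : probability T R) (X : nat -> T -> R) (n : nat) : set R :=
  [set v | exists k : nat, exists A B : set T,
     [/\ (1 <= k)%N,
         gen_sigma X [set i | (1 <= i <= k)%N] A,
         gen_sigma X [set i | (k + n <= i)%N] B,
         (0 < P A)%E &
         v = `| fine (P (A `&` B)) / fine (P A) - fine (P B) | ] ].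

Definition phi_coef {d} {T : measurableType d} {R : realType}
  (P : probability T R) (X : nat -> T -> R) (n : nat) : R :=
  sup (phi_values P X n).

Definition emp_df {d} {T : measurableType d} {R : realType}
  (X : nat -> T -> R) (n : nat) (w : T) (x : R) : R :=
  n%:R^-1 * \sum_(1 <= i < n.+1) ((X i w <= x)%R)%:R.

(* Main.v *)
Require Import Defs.
From HB Require Import structures.
From mathcomp Require Import all_boot all_order all_algebra.
From mathcomp Require Import all_classical all_reals all_analysis.
From mathcomp Require Import measurable_realfun zify ring lra.
Import Order.TTheory GRing.Theory Num.Theory.
Import numFieldNormedType.Exports.
Local Open Scope classical_set_scope.
Local Open Scope ring_scope.

(**
A Bernstein block argument. For events [A_i] in the sigma-algebra of [X_i], the
centered sum of [1_{A_i}] over [1..n] is cut into blocks of length [m], and even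
and odd blocks are treated separately, so that consecutive blocks of one parity
are separated by a gap of length [m]. The exponential of [lam] times a block sum
is a nonnegative combination of indicators with total coefficient at most
[exp (lam m) <= 2], so phi-mixing lets the expectation of the product factor over
the blocks, up to an extra term [2 phi(m)] in each factor; the variance of a block is at most [m g / 2] with
[g = 1 + 4 sum_n phi(n)^(1/2)], and [phi(m) <= (sum_n phi(n)^(1/2))^2 / m^2]
because [phi] is nonincreasing. With [lam = 4 (log n / (n g))^(1/2)] and [m] of
order [1 / lam] this bounds the probability that [|F_n(x) - F(x)|] exceeds
[((16 C_3 + theta) log n / (4 n))^(1/2)] by [4 n^-3]. A union bound over [n + 1]
equidistant points of the interval, whose mesh is below that same radius,
Borel-Cantelli, and the monotonicity of [F_n] and [F] give the uniform bound;
the mesh contributes the term with [d].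
*)

(** * Bounded measurable functions, with real-valued expectation and probability *)

Section bounded_measurable.
Context {d : measure_display} {T : measurableType d} {R : realType}.
Variable P : probability T R.
Implicit Types (U V : T -> R) (A B : set T).

(** On a probability space such functions are integrable, and the class is closed under sums,
    products and exponentials, so integrability follows from the shape of the function. *)
Definition bounded_mfun V :=
  measurable_fun setT V /\ exists M, forall w, `|V w| <= M.

Lemma bounded_mfun_cst (c : R) : bounded_mfun (fun=> c).
Proof. by split; [exact: measurable_cst | exists `|c|]. Qed.

Lemma bounded_mfunD U V : bounded_mfun U -> bounded_mfun V ->
  bounded_mfun (fun w => U w + V w).
Proof.
move=> [mU [a Ua]] [mV [b Vb]]; split; first exact: measurable_funD.
by exists (a + b) => w; rewrite (le_trans (ler_normD _ _))// lerD.
Qed.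

Lemma bounded_mfunM U V : bounded_mfun U -> bounded_mfun V ->
  bounded_mfun (fun w => U w * V w).
Proof.
move=> [mU [a Ua]] [mV [b Vb]]; split; first exact: measurable_funM.
by exists (a * b) => w; rewrite normrM ler_pM.
Qed.

Lemma bounded_mfun_indic A : measurable A -> bounded_mfun (\1_A : T -> R).
Proof.
move=> mA; split; first exact: measurable_indic.
by exists 1 => w; rewrite indicE ger0_norm ?ler0n// lern1 leq_b1.
Qed.

Lemma bounded_mfun_sum (I : Type) (s : seq I) (V : I -> T -> R) :
  (forall i, bounded_mfun (V i)) -> bounded_mfun (fun w => \sum_(i <- s) V i w).
Proof.
move=> bV; elim: s => [|i s ih].
  by under eq_fun do rewrite big_nil; exact: bounded_mfun_cst.
by under eq_fun do rewrite big_cons; exact: bounded_mfunD.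
Qed.

Lemma bounded_mfun_expR V : bounded_mfun V -> bounded_mfun (fun w => expR (V w)).
Proof.
move=> [mV [a Va]]; split; first by apply: measurableT_comp => //; exact: measurable_expR.
exists (expR a) => w; rewrite ger0_norm ?expR_ge0// ler_expR.
by rewrite (le_trans (ler_norm _)).
Qed.

Lemma bounded_mfun_integrable V : bounded_mfun V -> P.-integrable setT (EFin \o V).
Proof.
move=> [mV [a Va]]; apply: measurable_bounded_integrable => //.
  by apply: le_lt_trans (probability_le1 P measurableT) _; rewrite ltry.
exists a; split; first exact: num_real.
by move=> M aM w _ /=; rewrite (le_trans (Va w))// ltW.
Qed.

Definition mean V : R := \int[P]_w V w.

Definition pr A : R := fine (P A).

Lemma meanD U V : bounded_mfun U -> bounded_mfun V ->
  mean (fun w => U w + V w) = mean U + mean V.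
Proof. by move=> bU bV; apply: RintegralD => //; exact: bounded_mfun_integrable. Qed.

Lemma meanZ (c : R) V : bounded_mfun V -> mean (fun w => c * V w) = c * mean V.
Proof. by move=> bV; apply: RintegralZl => //; exact: bounded_mfun_integrable. Qed.

Lemma mean_le U V : bounded_mfun U -> bounded_mfun V ->
  (forall w, U w <= V w) -> mean U <= mean V.
Proof. by move=> bU bV UV; apply: le_Rintegral => //; exact: bounded_mfun_integrable. Qed.

Lemma mean_ge0 V : (forall w, 0 <= V w) -> 0 <= mean V.
Proof. by move=> V0; exact: Rintegral_ge0. Qed.

Lemma mean_cst (c : R) : mean (fun=> c) = c.
Proof.
by rewrite /mean Rintegral_cst//= probability_setT mulr1.
Qed.

Lemma mean_indic A : measurable A -> mean \1_A = pr A.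
Proof. by move=> mA; rewrite /mean /Rintegral integral_indic// setIT. Qed.

Lemma mean_sum (I : Type) (s : seq I) (V : I -> T -> R) :
  (forall i, bounded_mfun (V i)) ->
  mean (fun w => \sum_(i <- s) V i w) = \sum_(i <- s) mean (V i).
Proof.
move=> bV; elim: s => [|i s ih].
  by under [X in mean X]eq_fun do rewrite big_nil; rewrite big_nil mean_cst.
under [X in mean X]eq_fun do rewrite big_cons.
by rewrite meanD ?ih ?big_cons//; exact: bounded_mfun_sum.
Qed.

Lemma pr_ge0 A : 0 <= pr A. Proof. by rewrite fine_ge0. Qed.

Lemma EFin_pr A : measurable A -> (pr A)%:E = P A.
Proof. by move=> mA; rewrite fineK// fin_num_measure. Qed.

Lemma le_pr A B : measurable A -> measurable B -> A `<=` B -> pr A <= pr B.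
Proof.
by move=> mA mB AB; rewrite -lee_fin !EFin_pr// le_measure// inE.
Qed.

Lemma pr_le1 A : measurable A -> pr A <= 1.
Proof. by move=> mA; rewrite -lee_fin EFin_pr// probability_le1. Qed.

Lemma prC A : measurable A -> pr (~` A) = 1 - pr A.
Proof. by move=> mA; rewrite /pr probability_setC// fineB// fin_num_measure. Qed.

Lemma prU_le A B : measurable A -> measurable B -> pr (A `|` B) <= pr A + pr B.
Proof.
move=> mA mB; rewrite -lee_fin EFinD !EFin_pr//; last exact: measurableU.
exact: measureU2.
Qed.

Lemma bounded_mfun_measurable_ge V (c : R) : bounded_mfun V ->
  measurable [set w | c <= V w].
Proof.
move=> [mV _]; rewrite -[X in measurable X]setTI.
rewrite (_ : [set w | _] = V @^-1` `[c, +oo[); first exact: mV.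
by apply/seteqP; split => w /=; rewrite in_itv/= andbT.
Qed.

(** The indicator of [c <= V] is at most [exp (V - c)] pointwise. *)
Lemma markov_expR (c : R) V : bounded_mfun V ->
  pr [set w | c <= V w] <= expR (- c) * mean (fun w => expR (V w)).
Proof.
move=> bV; have mE := bounded_mfun_measurable_ge V c bV.
rewrite -mean_indic// -meanZ; last exact: bounded_mfun_expR.
apply: mean_le.
- exact: bounded_mfun_indic.
- by apply: bounded_mfunM; [exact: bounded_mfun_cst|exact: bounded_mfun_expR].
move=> w; rewrite indicE -expRD; have [|_] := boolP (w \in _); last exact: expR_ge0.
by rewrite inE/= => cV; rewrite -expR0 ler_expR; lra.
Qed.

End bounded_measurable.

(** * Nonnegative combinations of indicators *)

Section nnsimple.
Context {d : measure_display} {T : measurableType d} {R : realType}.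
Variable P : probability T R.
Implicit Types (U V : T -> R) (A B : set T) (G H : set (set T)).

(* [a] is the total mass of the coefficients; it bounds the oscillation of the
   function and is multiplicative under products. *)
Inductive nnsimple G : R -> (T -> R) -> Prop :=
| nnsimple_indic c A : 0 <= c -> G A -> nnsimple G c (fun w => c * \1_A w)
| nnsimpleD a b U V : nnsimple G a U -> nnsimple G b V ->
    nnsimple G (a + b) (fun w => U w + V w).

Lemma nnsimpleZ G a U (c : R) : 0 <= c -> nnsimple G a U ->
  nnsimple G (c * a) (fun w => c * U w).
Proof.
move=> c0; elim=> [c' A c'0 GA|a' b U' V' _ ihU _ ihV].
  by under eq_fun do rewrite mulrA; apply: nnsimple_indic => //; exact: mulr_ge0.
by rewrite mulrDr; under eq_fun do rewrite mulrDr; exact: nnsimpleD.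
Qed.

Lemma nnsimpleM G a b U V : setI_closed G -> nnsimple G a U -> nnsimple G b V ->
  nnsimple G (a * b) (fun w => U w * V w).
Proof.
move=> GI GU GV; elim: GU => [c A c0 GA|a' b' U' V' _ ihU _ ihV]; last first.
  by rewrite mulrDl; under eq_fun do rewrite mulrDl; exact: nnsimpleD.
elim: GV => [c' B c'0 GB|a' b' U' V' _ ihU _ ihV]; last first.
  by rewrite mulrDr; under eq_fun do rewrite mulrDr; exact: nnsimpleD.
rewrite (_ : (fun w => _) = fun w => (c * c') * \1_(A `&` B) w).
  by apply: nnsimple_indic; [exact: mulr_ge0|exact: GI].
by apply/funext => w; rewrite indicI/=; ring.
Qed.

Lemma nnsimple_prod G (s : seq nat) (a : nat -> R) (U : nat -> T -> R) :
  setI_closed G -> G setT -> (forall i, i \in s -> nnsimple G (a i) (U i)) ->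
  nnsimple G (\prod_(i <- s) a i) (fun w => \prod_(i <- s) U i w).
Proof.
move=> GI GT; elim: s => [|i s ih] GU.
  rewrite big_nil (_ : (fun w => _) = fun w => 1 * \1_setT w).
    exact: nnsimple_indic.
  by apply/funext => w; rewrite big_nil indicT mulr1.
rewrite big_cons (_ : (fun w => _) = fun w => U i w * \prod_(j <- s) U j w).
2: by apply/funext => w; rewrite big_cons.
apply: nnsimpleM => //; first by apply: GU; rewrite mem_head.
by apply: ih => j js; apply: GU; rewrite in_cons js orbT.
Qed.

Lemma nnsimple_total_ge0 G a U : nnsimple G a U -> 0 <= a.
Proof. by elim=> // a' b U' V' _ a0 _ b0; exact: addr_ge0. Qed.

Lemma nnsimple_bounded_mfun G a U : G `<=` measurable -> nnsimple G a U ->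
  bounded_mfun U.
Proof.
move=> mG; elim=> [c A c0 GA|a' b U' V' _ ihU _ ihV]; last exact: bounded_mfunD.
apply: bounded_mfunM; first exact: bounded_mfun_cst.
by apply: bounded_mfun_indic; exact: mG.
Qed.

(** Both sides are additive in [U], and also in [V] together with its mass [b], so a double
    induction reduces to indicators. The error stays inside the factor of [V], which lets the bound
    be iterated. *)
Lemma mean_nnsimpleM_le G H (e a b : R) U V :
  G `<=` measurable -> H `<=` measurable ->
  (forall A B, G A -> H B -> pr P (A `&` B) <= pr P A * (pr P B + e)) ->
  nnsimple G a U -> nnsimple H b V ->
  mean P (fun w => U w * V w) <= mean P U * (mean P V + e * b).
Proof.
move=> mG mH GH GU HV; have bV := nnsimple_bounded_mfun H b V mH HV.
elim: GU => [c A c0 GA|a' b' U' V' GU ihU GV ihV]; last first.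
  have bU := nnsimple_bounded_mfun _ _ _ mG GU.
  have bV' := nnsimple_bounded_mfun _ _ _ mG GV.
  under [X in mean P X]eq_fun do rewrite mulrDl.
  by rewrite !meanD ?mulrDl ?lerD//; exact: bounded_mfunM.
have mA := mG _ GA; have bA := bounded_mfun_indic A mA.
under [X in mean P X]eq_fun do rewrite -mulrA.
rewrite !meanZ//; last exact: bounded_mfunM.
rewrite mean_indic// -mulrA; apply: ler_wpM2l => //.
elim: HV {bV} => [c' B c'0 HB|a' b' U' V' HU ihU HV ihV]; last first.
  have bU := nnsimple_bounded_mfun _ _ _ mH HU.
  have bV' := nnsimple_bounded_mfun _ _ _ mH HV.
  under [X in mean P X]eq_fun do rewrite mulrDr.
  rewrite !meanD//; [|exact: bounded_mfunM..].
  by apply: le_trans (lerD ihU ihV) _; rewrite -mulrDr; apply: ler_wpM2l; [exact: pr_ge0|lra].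
have mB := mH _ HB.
rewrite (_ : (fun w => _) = fun w => c' * \1_(A `&` B) w); last first.
  by apply/funext => w; rewrite indicI/=; ring.
rewrite !meanZ ?mean_indic//; [|exact: measurableI|exact: bounded_mfun_indic|
  by apply: bounded_mfun_indic; exact: measurableI].
have := ler_wpM2l c'0 (GH _ _ GA HB); nra.
Qed.

End nnsimple.

(** * Properties of the mixing coefficients *)

Section mixing_coefficients.
Context {d : measure_display} {T : measurableType d} {R : realType}.
Variables (P : probability T R) (X : nat -> {RV P >-> R}).
Local Notation X' := (fun i => X i : T -> R).
Local Notation phi := (phi_coef P X').

Lemma gen_sigma_measurable (I : set nat) : gen_sigma X' I `<=` measurable.
Proof.
apply: smallest_sub; first exact: sigma_algebra_measurable.
move=> _ [i Ii [B mB <-]]; rewrite -[X in measurable X]setTI.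
exact: measurable_funP.
Qed.

Lemma gen_sigmaS (I J : set nat) : I `<=` J -> gen_sigma X' I `<=` gen_sigma X' J.
Proof. by move=> IJ; apply: sub_sigma_algebra2; exact: bigcup_subset. Qed.

Lemma gen_sigmaT (I : set nat) : gen_sigma X' I setT.
Proof.
rewrite -(setD0 setT).
by apply: sigma_algebraCD; exact: sigma_algebra0.
Qed.

Lemma gen_sigma_setI_closed (I : set nat) : setI_closed (gen_sigma X' I).
Proof.
by have /(sigma_algebraP (fun _ _ => @subsetT _ _))[_ _ _] :=
  @smallest_sigma_algebra _ setT
    (\bigcup_(i in I) [set X' i @^-1` B | B in [set B : set R | measurable B]]).
Qed.

Lemma gen_sigma_preimage (I : set nat) i (B : set R) : I i -> measurable B ->
  gen_sigma X' I (X i @^-1` B).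
Proof. by move=> Ii mB; apply: sub_sigma_algebra; exists i => //; exists B. Qed.

(** Nonemptiness; with the upper bound 1 it makes the [sup] in [phi_coef] a genuine supremum. *)
Lemma phi_values0 n : phi_values P X' n 0.
Proof.
exists 1%N, setT, setT; split => //; [exact: gen_sigmaT..| |].
  by rewrite probability_setT lte01.
by rewrite setTI probability_setT/= divr1 subrr normr0.
Qed.

Lemma phi_values_le1 n : ubound (phi_values P X' n) 1.
Proof.
move=> _ [k [A [B [k1 GA GB PA ->]]]].
have mA := gen_sigma_measurable _ _ GA; have mB := gen_sigma_measurable _ _ GB.
have A0 : 0 < pr P A by rewrite -lte_fin EFin_pr.
have AB1 : pr P (A `&` B) / pr P A <= 1.
  by rewrite ler_pdivrMr// mul1r le_pr//; exact: measurableI.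
have AB0 : 0 <= pr P (A `&` B) / pr P A by rewrite divr_ge0 ?pr_ge0.
have B0 := pr_ge0 P B; have B1 := pr_le1 P B mB.
by rewrite -!/(pr P _) ler_norml; apply/andP; split; lra.
Qed.

Lemma phi_values_le n v : phi_values P X' n v -> v <= phi n.
Proof. by apply: ub_le_sup; exists 1; exact: phi_values_le1. Qed.

Lemma phi_ge0 n : 0 <= phi n.
Proof. exact/phi_values_le/phi_values0. Qed.

Lemma phi_le1 n : phi n <= 1.
Proof. by apply: ge_sup; [exists 0; exact: phi_values0|exact: phi_values_le1]. Qed.

(** A longer gap shrinks the sigma-algebra of the future, hence the set of values. *)
Lemma phi_antitone m n : (m <= n)%N -> phi n <= phi m.
Proof.
move=> mn; apply: ge_sup; first by exists 0; exact: phi_values0.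
move=> v [k [A [B [k1 GA GB PA ->]]]]; apply: phi_values_le.
exists k, A, B; split => //; apply: gen_sigmaS GB => i /=; apply: leq_trans.
by rewrite leq_add2l.
Qed.

Lemma phi_mixing n k A B : (1 <= k)%N ->
  gen_sigma X' [set i | (1 <= i <= k)%N] A ->
  gen_sigma X' [set i | (k + n <= i)%N] B ->
  `|pr P (A `&` B) - pr P A * pr P B| <= pr P A * phi n.
Proof.
move=> k1 GA GB.
have mA := gen_sigma_measurable _ _ GA; have mB := gen_sigma_measurable _ _ GB.
(* The definition of [phi_values] divides by [P A]; for a null [A] both sides vanish. *)
have [A0|A0] := eqVneq (pr P A) 0.
  have AB0 : pr P (A `&` B) = 0.
    apply/eqP; rewrite eq_le pr_ge0 andbT -A0 le_pr//; exact: measurableI.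
  by rewrite AB0 A0 !mul0r subrr normr0.
have Ap : 0 < pr P A by rewrite lt_neqAle eq_sym A0 pr_ge0.
rewrite (_ : _ - _ = pr P A * (pr P (A `&` B) / pr P A - pr P B)); last by field.
rewrite normrM (gtr0_norm Ap) ler_pM2l//; apply: phi_values_le.
by exists k, A, B; split => //; rewrite -EFin_pr// lte_fin.
Qed.

Hypothesis sum_phi : (\sum_(1 <= n <oo) (Num.sqrt (phi n))%:E < +oo)%E.

Definition sum_sqrt_phi : R := fine (\sum_(1 <= n <oo) (Num.sqrt (phi n))%:E)%E.

Lemma sum_sqrt_phi_ge n : \sum_(1 <= i < n) Num.sqrt (phi i) <= sum_sqrt_phi.
Proof.
rewrite -lee_fin fineK.
  rewrite -sumEFin; apply: nneseries_lim_ge => i _ _.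
  by rewrite lee_fin sqrtr_ge0.
by rewrite ge0_fin_numE// nneseries_ge0// => i _ _; rewrite lee_fin sqrtr_ge0.
Qed.

Lemma sum_sqrt_phi_ge0 : 0 <= sum_sqrt_phi.
Proof. by have := sum_sqrt_phi_ge 1; rewrite big_geq. Qed.

Lemma sum_phi_le n : \sum_(1 <= i < n) phi i <= sum_sqrt_phi.
Proof.
apply: le_trans (sum_sqrt_phi_ge n); apply: ler_sum => i _.
rewrite -[leLHS]sqr_sqrtr ?phi_ge0// expr2 ler_piMr ?sqrtr_ge0//.
by rewrite -[leRHS]sqrtr1 ler_wsqrtr// phi_le1.
Qed.

(** By monotonicity each of the first [m] terms of the series is at least [sqrt (phi m)], so
    [m sqrt (phi m)] is at most its sum. *)
Lemma phi_sqr_le m : m%:R ^+ 2 * phi m <= sum_sqrt_phi ^+ 2.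
Proof.
rewrite -(sqr_sqrtr (phi_ge0 m)) -exprMn ler_pXn2r ?nnegrE ?sum_sqrt_phi_ge0//.
  apply: le_trans (sum_sqrt_phi_ge m.+1).
  rewrite mulr_natl.
  have -> : Num.sqrt (phi m) *+ m = \sum_(1 <= i < m.+1) Num.sqrt (phi m).
    by rewrite sumr_const_nat subn1.
  rewrite big_nat [leRHS]big_nat; apply: ler_sum => i /andP[_ im].
  by rewrite ler_wsqrtr// phi_antitone.
Qed.

End mixing_coefficients.

(** Squaring [exp (x/2) (1 - x/2) <= 1] gives [exp x (1 - x/2)^2 <= 1], so it suffices that
    [(1 + x + x^2) (1 - x/2)^2 >= 1]. *)
Lemma expR_le_quadratic (R : realType) (x : R) : x <= 1 / 4 ->
  expR x <= 1 + x + x ^+ 2.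
Proof.
move=> x4; have u0 : 0 < 1 - x / 2 by lra.
have := expR_ge1Dx (- (x / 2)); rewrite expRN => ue.
have e0 := expR_gt0 (x / 2).
have eu : expR (x / 2) * (1 - x / 2) <= 1.
  by rewrite -[leRHS](@mulfV _ (expR (x / 2))) ?gt_eqF// ler_pM2l.
have -> : expR x = expR (x / 2) ^+ 2 by rewrite expr2 -expRD; congr expR; lra.
rewrite -(@ler_pM2r _ ((1 - x / 2) ^+ 2)) ?exprn_gt0//.
have : (expR (x / 2) * (1 - x / 2)) ^+ 2 <= 1.
  by rewrite expr_le1// mulr_ge0 ?ltW.
rewrite exprMn => /le_trans; apply.
(* A quarter of this product is [(1 + x + x^2) (1 - x/2)^2 - 1]. *)
have : 0 <= x ^+ 2 * (1 - 3 * x + x ^+ 2).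
  by rewrite mulr_ge0 ?sqr_ge0//; have := sqr_ge0 x; lra.
nra.
Qed.

(** * Moments of block sums of centered indicators *)

Section event_sums.
Context {d : measure_display} {T : measurableType d} {R : realType}.
Variables (P : probability T R) (X : nat -> {RV P >-> R}).
Local Notation X' := (fun i => X i : T -> R).
Local Notation phi := (phi_coef P X').
Hypothesis sum_phi : (\sum_(1 <= n <oo) (Num.sqrt (phi n))%:E < +oo)%E.
Local Notation Phi := (sum_sqrt_phi P X).
Variable A : nat -> set T.
Hypothesis hA : forall i (I : set nat), I i -> gen_sigma X' I (A i).
Local Notation p i := (pr P (A i)).

Definition centered i (w : T) : R := \1_(A i) w - p i.
Local Notation Y := centered.

Let mA i : measurable (A i).
Proof. by apply: (@gen_sigma_measurable _ _ _ P X [set i]); exact: hA. Qed.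

Lemma centered_bounded_mfun i : bounded_mfun (Y i).
Proof.
by apply: bounded_mfunD; [exact: bounded_mfun_indic|exact: bounded_mfun_cst].
Qed.
Local Hint Resolve centered_bounded_mfun : core.

Lemma mean_centered i : mean P (Y i) = 0.
Proof.
rewrite meanD ?mean_cst ?mean_indic ?subrr//; first exact: bounded_mfun_indic.
exact: bounded_mfun_cst.
Qed.

Lemma mean_centeredM i j :
  mean P (fun w => Y i w * Y j w) = pr P (A i `&` A j) - p i * p j.
Proof.
have bI B : measurable B -> forall c : R, bounded_mfun (fun w => c * \1_B w).
  move=> mB c; apply: bounded_mfunM; first exact: bounded_mfun_cst.
  exact: bounded_mfun_indic.
have mAA : measurable (A i `&` A j) by exact: measurableI.
rewrite (_ : (fun w => _) = fun w => \1_(A i `&` A j) w +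
    (- p j * \1_(A i) w + (- p i * \1_(A j) w + p i * p j))); last first.
  by apply/funext => w; rewrite /Y indicI/=; ring.
have bC := bounded_mfun_cst (p i * p j : R) (T := T).
rewrite !meanD ?mean_cst ?meanZ ?mean_indic//; do ?exact: bounded_mfun_indic;
  do ?[apply: bounded_mfunD => //]; do ?exact: bI; do ?[apply: bounded_mfunD => //];
  do ?exact: bI; rewrite /pr; lra.
Qed.

(** The variance is [p (1 - p) <= 1/4]; the weaker constant turns the block bound below into
    [m g / 2]. *)
Lemma mean_centered_sqr_le i : mean P (fun w => Y i w * Y i w) <= 1 / 2.
Proof.
rewrite mean_centeredM setIid; have := sqr_ge0 (p i - 1 / 2); nra.
Qed.

Lemma mean_centeredM_le i j : (1 <= i < j)%N ->
  mean P (fun w => Y i w * Y j w) <= phi (j - i).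
Proof.
move=> /andP[i1 ij]; rewrite mean_centeredM.
apply: le_trans (ler_norm _) _.
apply: (@le_trans _ _ (p i * phi (j - i))).
  apply: (@phi_mixing _ _ _ P X (j - i) i) => //; apply: hA => /=.
    by rewrite i1 leqnn.
  by rewrite subnKC// ltnW.
by rewrite ler_piMl ?phi_ge0// pr_le1.
Qed.

Definition block a m (w : T) : R := \sum_(a <= i < a + m) Y i w.

Lemma block_bounded_mfun a m : bounded_mfun (block a m).
Proof. exact: bounded_mfun_sum. Qed.
Local Hint Resolve block_bounded_mfun : core.

Lemma mean_block a m : mean P (block a m) = 0.
Proof. by rewrite mean_sum// big1// => i _; exact: mean_centered. Qed.

Lemma mean_block_centered_le a m : (1 <= a)%N ->
  mean P (fun w => block a m w * Y (a + m) w) <= Phi.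
Proof.
move=> a1; rewrite (_ : (fun w => _) =
    fun w => \sum_(a <= i < a + m) (Y i w * Y (a + m) w)); last first.
  by apply/funext => w; rewrite /block mulr_suml.
rewrite mean_sum; last by move=> i; exact: bounded_mfunM.
apply: (@le_trans _ _ (\sum_(a <= i < a + m) phi (a + m - i))).
  rewrite big_nat [leRHS]big_nat; apply: ler_sum => i /andP[ai im].
  by apply: mean_centeredM_le; rewrite im (leq_trans a1).
apply: le_trans (sum_phi_le P X sum_phi m.+1).
(* Reversing the summation turns the distances [a + m - i] into [1, ..., m]. *)
rewrite big_nat_rev/= -{1}[a]add0n big_addn addKn big_add1/=.
rewrite big_nat [leRHS]big_nat; apply: ler_sum => i /andP[_ im].
by rewrite le_eqVlt; apply/orP; left; apply/eqP; congr phi; lia.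
Qed.

(** Appending the index [a + m] costs twice its covariance with the block, at most [2 Phi], plus one
    variance. *)
Lemma mean_block_sqr_le a m : (1 <= a)%N ->
  mean P (fun w => block a m w * block a m w) <= m%:R * (1 / 2 + 2 * Phi).
Proof.
move=> a1; elim: m => [|m ih].
  rewrite (_ : (fun w => _) = fun=> 0) ?mean_cst ?mul0r//.
  by apply/funext => w; rewrite /block big_geq ?mul0r// addn0.
rewrite (_ : (fun w => _) = fun w => block a m w * block a m w +
    (2 * (block a m w * Y (a + m) w) + Y (a + m) w * Y (a + m) w)); last first.
  by apply/funext => w; rewrite /block addnS big_nat_recr ?leq_addr//=; ring.
have bB : bounded_mfun (fun w => block a m w * Y (a + m) w) by exact: bounded_mfunM.
rewrite !meanD ?meanZ//; do ?[exact: bounded_mfunM|apply: bounded_mfunD];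
  do ?exact: bounded_mfunM; do ?[apply: bounded_mfunM => //; exact: bounded_mfun_cst].
have := mean_block_centered_le a m a1; have := mean_centered_sqr_le (a + m).
rewrite -(natr1 m); lra.
Qed.

(** * Exponential moments of separated blocks *)

Section exponential_moment.
Variables (lam : R) (m : nat).
Hypotheses (lam0 : 0 <= lam) (lam_m : lam * m%:R <= 1 / 4).

Definition expblock a (w : T) : R := expR (lam * block a m w).

Lemma expblock_bounded_mfun a : bounded_mfun (expblock a).
Proof.
by apply/bounded_mfun_expR/bounded_mfunM => //; exact: bounded_mfun_cst.
Qed.
Local Hint Resolve expblock_bounded_mfun : core.

Lemma block_le a w : block a m w <= m%:R.
Proof.
rewrite /block -[leRHS](_ : \sum_(a <= i < a + m) 1 = _).
  apply: ler_sum => i _; rewrite /Y indicE.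
  have := pr_ge0 P (A i); have : ((w \in A i)%:R : R) <= 1 by rewrite lern1 leq_b1.
  lra.
by rewrite sumr_const_nat addKn.
Qed.

(** The quadratic bound on the exponential applies because [lam m <= 1/4], and the linear term has
    mean zero. *)
Lemma mean_expblock_le a : (1 <= a)%N ->
  mean P (expblock a) <= 1 + lam ^+ 2 * m%:R * (1 / 2 + 2 * Phi).
Proof.
move=> a1.
have b1 : bounded_mfun (fun w => lam * block a m w).
  by apply: bounded_mfunM => //; exact: bounded_mfun_cst.
have b2 : bounded_mfun (fun w => lam ^+ 2 * (block a m w * block a m w)).
  by apply: bounded_mfunM; [exact: bounded_mfun_cst|exact: bounded_mfunM].
apply: (@le_trans _ _ (mean P (fun w => 1 + (lam * block a m w +
    lam ^+ 2 * (block a m w * block a m w))))).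
  apply: mean_le => //.
    by apply: bounded_mfunD; [exact: bounded_mfun_cst|exact: bounded_mfunD].
  move=> w; apply: le_trans (expR_le_quadratic _ _ _) _.
    by apply: le_trans lam_m; rewrite ler_wpM2l// block_le.
  by rewrite exprMn -expr2 addrA.
rewrite !meanD//; [|exact: bounded_mfun_cst|exact: bounded_mfunD].
rewrite mean_cst !meanZ//; last exact: bounded_mfunM.
rewrite mean_block mulr0 add0r lerD2l -mulrA.
by rewrite ler_wpM2l ?sqr_ge0// mean_block_sqr_le.
Qed.

(** Each factor is [exp (- lam p) (1 + (exp lam - 1) 1_A)], of total mass [exp (lam (1 - p))]; the
    product of the masses is at most [exp (1/4) <= 2]. *)
Lemma expblock_nnsimple a (I : set nat) :
  (forall i, (a <= i < a + m)%N -> I i) ->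
  exists2 b, b <= 2 & nnsimple (gen_sigma X' I) b (expblock a).
Proof.
move=> aI; exists (\prod_(a <= i < a + m) expR (lam * (1 - p i))).
  rewrite -expR_sum; apply: (@le_trans _ _ (expR (1 / 4))).
    rewrite ler_expR -mulr_sumr; apply: le_trans lam_m; rewrite ler_wpM2l//.
    rewrite -[leRHS](_ : \sum_(a <= i < a + m) 1 = _).
      by apply: ler_sum => i _; have := pr_ge0 P (A i); lra.
    by rewrite sumr_const_nat addKn.
  by apply: le_trans (expR_le_quadratic _ _ _) _ => //; lra.
rewrite (_ : expblock a =
    fun w => \prod_(a <= i < a + m) (expR (- (lam * p i)) *
      (1 * \1_setT w + (expR lam - 1) * \1_(A i) w))); last first.
  apply/funext => w; rewrite /expblock /block mulr_sumr expR_sum.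
  apply: eq_bigr => i _; rewrite /Y mulrBr expRD [LHS]mulrC; congr *%R.
  rewrite indicT !indicE; case: (w \in A i); rewrite ?mulr1 ?mulr0 ?expR0; lra.
apply: nnsimple_prod; [exact: gen_sigma_setI_closed|exact: gen_sigmaT|].
move=> i; rewrite mem_index_iota => /aI Ii.
rewrite (_ : expR _ = expR (- (lam * p i)) * (1 + (expR lam - 1))); last first.
  by rewrite (_ : 1 + (expR lam - 1) = expR lam) -?expRD; [congr expR|]; ring.
apply: nnsimpleZ; first exact: expR_ge0.
apply: nnsimpleD; apply: nnsimple_indic => //; first exact: gen_sigmaT.
  by rewrite subr_ge0 -expR0 ler_expR.
exact: hA.
Qed.

Hypothesis m0 : (0 < m)%N.

(* The blocks [[1 + o + 2 k m, o + (2 k + 1) m]], [k < K], are separated by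
   gaps of length [m]. *)
Definition spaced_blocks o K (w : T) : R :=
  \sum_(0 <= k < K) block (1 + o + k * m.*2) m w.

Lemma spaced_blocks_bounded_mfun o K : bounded_mfun (spaced_blocks o K).
Proof. exact: bounded_mfun_sum. Qed.

(** Logarithmic cost of one block: the variance term, plus the mixing error [phi m] times the mass
    bound 2. *)
Definition step_exponent := lam ^+ 2 * m%:R * (1 / 2 + 2 * Phi) + 2 * phi m.

(** The last block is peeled off across its gap by [mean_nnsimpleM_le], and [1 + x <= exp x] absorbs
    its factor. *)
Lemma mean_spaced_blocks_le o K :
  mean P (fun w => expR (lam * spaced_blocks o K w)) <= expR (K%:R * step_exponent).
Proof.
have rec k w : expR (lam * spaced_blocks o k.+1 w) =
    expR (lam * spaced_blocks o k w) * expblock (1 + o + k * m.*2) w.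
  by rewrite /spaced_blocks big_nat_recr//= mulrDr expRD.
have simp k : (0 < k)%N -> exists b, nnsimple
    (gen_sigma X' [set i | (1 <= i <= o + k.-1 * m.*2 + m)%N]) b
    (fun w => expR (lam * spaced_blocks o k w)).
  (* [xget] names a total mass for each block, which exists for [j < k]. Only the mass of the new
     block enters the error, so any [b] will do for the past. *)
  move=> k0; exists (\prod_(0 <= j < k) xget 0 [set b | nnsimple
    (gen_sigma X' [set i | (1 <= i <= o + k.-1 * m.*2 + m)%N]) b
    (expblock (1 + o + j * m.*2))]).
  rewrite (_ : (fun w => _) =
      fun w => \prod_(0 <= j < k) expblock (1 + o + j * m.*2) w); last first.
    by apply/funext => w; rewrite /spaced_blocks mulr_sumr expR_sum.
  apply: nnsimple_prod; [exact: gen_sigma_setI_closed|exact: gen_sigmaT|].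
  move=> j; rewrite mem_index_iota => /andP[_ jk].
  case: xgetP => //; have [|b _ hb] := expblock_nnsimple (1 + o + j * m.*2)
    [set i | (1 <= i <= o + k.-1 * m.*2 + m)%N]; last by move=> /(_ b).
  move=> i /= /andP[ji ij]; apply/andP; split; first lia.
  have : (j * m.*2 <= k.-1 * m.*2)%N by rewrite leq_mul2r; lia.
  lia.
elim: K => [|k ih].
  rewrite mul0r expR0 (_ : (fun w => _) = fun=> 1) ?mean_cst//.
  by apply/funext => w; rewrite /spaced_blocks big_geq// mulr0 expR0.
under [X in mean P X]eq_fun do rewrite rec.
have step1 : mean P (expblock (1 + o + k * m.*2)) + phi m * 2 <= expR step_exponent.
  apply: le_trans (expR_ge1Dx _); rewrite /step_exponent.
  by have := mean_expblock_le (1 + o + k * m.*2) isT; lra.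
rewrite -(natr1 k) mulrDl mul1r expRD.
have ph := phi_ge0 P X m.
(* For [k = 0] there is no past to separate: the mean is that of a single block. *)
have [k0|k0] := posnP k.
  rewrite k0 mul0r expR0 mul1r (_ : (fun w => _) = expblock (1 + o + 0 * m.*2)).
    by apply: le_trans step1; rewrite k0; lra.
  by apply/funext => w; rewrite /spaced_blocks big_geq// mulr0 expR0 mul1r.
have [b sb] := simp k k0.
have [|c c2 sc] := expblock_nnsimple (1 + o + k * m.*2)
  [set i | (o + k.-1 * m.*2 + m + m <= i)%N].
  move=> i /= /andP[ki _]; apply: leq_trans ki.
  by case: k k0 {ih sb step1} => // k _; rewrite mulSn; lia.
apply: le_trans (@mean_nnsimpleM_le _ _ _ P _ _ (phi m) _ _ _ _ _ _ _ sb sc) _.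
- exact: gen_sigma_measurable.
- exact: gen_sigma_measurable.
- move=> B C GB GC.
  have q1 : (1 <= o + k.-1 * m.*2 + m)%N by rewrite addn_gt0 m0 orbT.
  have := @phi_mixing _ _ _ P X m _ B C q1 GB GC.
  by rewrite ler_norml => /andP[_]; rewrite mulrDr; lra.
apply: ler_pM => //; first by apply: mean_ge0 => w; exact: expR_ge0.
  rewrite addr_ge0 ?mean_ge0//; first by move=> w; exact: expR_ge0.
  by rewrite mulr_ge0// (nnsimple_total_ge0 _ _ _ sc).
by apply: le_trans step1; rewrite lerD2l ler_wpM2l.
Qed.

(** Each stretch of [2 m] indices is one block of the family at offset 0 followed by one of the
    family at offset [m]. *)
Lemma block_double K w :
  block 1 (K * m.*2) w = spaced_blocks 0 K w + spaced_blocks m K w.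
Proof.
elim: K => [|K ih].
  by rewrite /block /spaced_blocks !big_geq ?addr0.
rewrite /spaced_blocks !big_nat_recr//= -!/(spaced_blocks _ _ _).
have -> : block 1 (K.+1 * m.*2) w = block 1 (K * m.*2) w +
    (block (1 + 0 + K * m.*2) m w + block (1 + m + K * m.*2) m w).
  rewrite /block addn0 (@big_cat_nat _ _ _ (1 + K * m.*2)) ?leq_addr//=; last first.
    by rewrite mulSn; lia.
  congr +%R; rewrite (@big_cat_nat _ _ _ (1 + K * m.*2 + m)) ?leq_addr//=; last first.
    by rewrite mulSn; lia.
  rewrite addnAC (_ : 1 + m + K * m.*2 + m = 1 + K.+1 * m.*2)%N//.
  by rewrite mulSn; lia.
rewrite ih; ring.
Qed.

(** If the sum reaches [t], one of the two families reaches [t / 2]; Markov's inequality for each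
    gives the factor 2. *)
Lemma pr_block_ge_le K (t : R) :
  pr P [set w | t <= block 1 (K * m.*2) w] <=
  2 * expR (- (lam * t / 2) + K%:R * step_exponent).
Proof.
have hm o : measurable [set w | lam * t / 2 <= lam * spaced_blocks o K w].
  apply: bounded_mfun_measurable_ge; apply: bounded_mfunM.
    exact: bounded_mfun_cst.
  exact: spaced_blocks_bounded_mfun.
have ho o : pr P [set w | lam * t / 2 <= lam * spaced_blocks o K w] <=
    expR (- (lam * t / 2) + K%:R * step_exponent).
  rewrite expRD.
  apply: le_trans (markov_expR P (lam * t / 2) _ _) _.
    apply: bounded_mfunM; first exact: bounded_mfun_cst.
    exact: spaced_blocks_bounded_mfun.
  by rewrite ler_wpM2l ?expR_ge0// mean_spaced_blocks_le.
apply: (@le_trans _ _ (pr P ([set w | lam * t / 2 <= lam * spaced_blocks 0 K w] `|`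
   [set w | lam * t / 2 <= lam * spaced_blocks m K w]))).
  apply: le_pr; [exact: bounded_mfun_measurable_ge|exact: measurableU|].
  move=> w /=; rewrite block_double => tw.
  have [h|h] := leP (t / 2) (spaced_blocks 0 K w).
    by left; rewrite -mulrA ler_wpM2l.
  by right; rewrite -mulrA ler_wpM2l//; lra.
by apply: le_trans (prU_le _ _ _ _ _) _ => //; have := lerD (ho 0%N) (ho m); lra.
Qed.

End exponential_moment.
End event_sums.

(** [L^4 / 4!] is one term of the exponential series at [L = ln n]. *)
Lemma ln_pow4_le (R : realType) n : 0 <= ln (n%:R : R) -> (0 < n)%N ->
  ln (n%:R : R) ^+ 4 <= 24 * n%:R.
Proof.
move=> L0 n0; have := expR_ge1Dxn 3 L0.
rewrite lnK ?posrE ?ltr0n// -[4`!%:R](_ : 24%:R = _)//; lra.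
Qed.

(** [ln 0 = 0] here, so a positive lower bound on [ln n] excludes [n = 0]. *)
Lemma ln_natr_ge_gt0 (R : realType) (c : R) n : 0 < c -> c <= ln n%:R -> (0 < n)%N.
Proof. by case: n => //; rewrite ln0//; lra. Qed.

(** * One-sided deviation bound: choice of [lam] and of the block length *)

Section deviation.
Context {d : measure_display} {T : measurableType d} {R : realType}.
Variables (P : probability T R) (X : nat -> {RV P >-> R}).
Local Notation X' := (fun i => X i : T -> R).
Local Notation phi := (phi_coef P X').
Hypothesis sum_phi : (\sum_(1 <= n <oo) (Num.sqrt (phi n))%:E < +oo)%E.
Local Notation Phi := (sum_sqrt_phi P X).
Local Notation g := (1 + 4 * Phi).

Lemma pr_sum_ge_le (A : nat -> set T) (lam t : R) n m :
  (forall i (I : set nat), I i -> gen_sigma X' I (A i)) ->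
  0 <= lam -> (0 < m)%N -> lam * m%:R <= 1 / 4 ->
  pr P [set w | t <= \sum_(1 <= i < n.+1) centered P A i w] <=
  2 * expR (- (lam * t / 2) +
    (n %/ m.*2).+1%:R * (lam ^+ 2 * m%:R * (1 / 2 + 2 * Phi) + 2 * phi m)).
Proof.
(* Empty events, whose centered indicators vanish, pad the sum up to a multiple of [2 m]. *)
move=> hA lam0 m0 lam_m; pose A' i := if (i <= n)%N then A i else set0.
have hA' i (I : set nat) : I i -> gen_sigma X' I (A' i).
  by rewrite /A'; case: ifP => _ Ii; [exact: hA|exact: sigma_algebra0].
have := pr_block_ge_le P X sum_phi A' hA' lam m lam0 lam_m m0 (n %/ m.*2).+1 t.
rewrite (_ : [set w | _] = [set w | t <= \sum_(1 <= i < n.+1) centered P A i w])//.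
apply/seteqP; rewrite /block.
have nK : (n.+1 <= 1 + (n %/ m.*2).+1 * m.*2)%N.
  by rewrite add1n ltnS ltnW// ltn_ceil// double_gt0.
suff E w : \sum_(1 <= i < 1 + (n %/ m.*2).+1 * m.*2) centered P A' i w =
    \sum_(1 <= i < n.+1) centered P A i w by split => w /=; rewrite E.
rewrite (@big_cat_nat _ _ _ n.+1)//= [X in _ + X]big_nat_cond [X in _ + X]big1; last first.
  move=> i /andP[/andP[ni _] _]; rewrite /centered /A' leqNgt ni/=.
  by rewrite indic0 /pr measure0 subrr.
rewrite addr0 big_nat [RHS]big_nat; apply: eq_bigr => i /andP[_ iN].
by rewrite /centered /A' -ltnS iN.
Qed.

(** With [L = ln n] the exponent is at most [- 8 L + 4 L + L], from [lam t / 2], the variances and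
    the errors. The threshold [c] is uniform in [t] and [A], and the power 3 leaves a summable bound
    after a union over [n + 1] points. *)
Lemma eventually_pr_sum_ge_le : exists2 c : R, 1 <= c & forall n (t : R) (A : nat -> set T),
  (forall i (I : set nat), I i -> gen_sigma X' I (A i)) ->
  c <= ln n%:R -> 0 <= t -> 16 * g * n%:R * ln n%:R <= t ^+ 2 ->
  pr P [set w | t <= \sum_(1 <= i < n.+1) centered P A i w] <=
  2 * expR (- (3 * ln n%:R)).
Proof.
have Phi0 := sum_sqrt_phi_ge0 P X sum_phi.
have Phi20 := sqr_ge0 Phi.
(* [C] collects the error coefficients of [K1] and [K2]. As [64 * 384 = 24 * 32^2], the threshold
   below and [L^4 <= 24 n] yield [8 C lam <= 1]. *)
pose C := g + 64 * 132 * Phi ^+ 2.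
have C1 : 1 <= C by rewrite /C; lra.
have C21 : 1 <= C ^+ 2 by rewrite expr_ge1//; lra.
exists (64 * 384 * C ^+ 2); first lra.
move=> n t A hA; set L := ln n%:R => cL t0 tL.
have L1 : 1 <= L by lra.
have n0 : (0 < n)%N by exact: ln_natr_ge_gt0 ltr01 L1.
have nR0 : 0 < n%:R :> R by rewrite ltr0n.
have g0 : 0 < g by lra.
have L4 : L ^+ 4 <= 24 * n%:R by apply: ln_pow4_le => //; rewrite -/L; lra.
(* The minimiser of [- lam t / 2 + n lam^2 g / 4] at [t^2 = 16 g n L]. *)
pose lam := 4 * Num.sqrt (L / (n%:R * g)).
have lam2 : lam ^+ 2 = 16 * L / (n%:R * g).
  rewrite exprMn sqr_sqrtr; last by rewrite divr_ge0 ?mulr_ge0; lra.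
  by field; rewrite !gt_eqF.
have lam0 : 0 < lam.
  by rewrite mulr_gt0// sqrtr_gt0 divr_gt0 ?mulr_gt0; lra.
have nlam2 : n%:R * lam ^+ 2 * g = 16 * L.
  by rewrite lam2; field; rewrite !gt_eqF.
have lamC : lam * (8 * C) <= 1.
  rewrite -(@expr_le1 _ 2)//; last by rewrite mulr_ge0; lra.
  rewrite exprMn -(@ler_pM2l _ (n%:R * g)) ?mulr_gt0// mulrA lam2 mulr1.
  rewrite [leLHS](_ : _ = L * (32 * 32 * C ^+ 2)); last by field; rewrite !gt_eqF.
  apply: (@le_trans _ _ n%:R); last by rewrite ler_peMr; lra.
  have : L * (64 * 384 * C ^+ 2) <= L * L by rewrite ler_wpM2l; lra.
  have : 1 * (L * L) <= L ^+ 2 * (L * L) by apply: ler_wpM2r; [nra|rewrite expr_ge1//; lra].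
  by rewrite -expr2 -exprD; lra.
have lam8 : lam * 8 <= 1 by apply: le_trans lamC; rewrite ler_wpM2l; lra.
(* The largest [m] with [lam m <= 1/4]; as [lam <= 1/8], also [8 lam m >= 1]. *)
pose m := Num.truncn (1 / (4 * lam)).
have x0 : 0 <= 1 / (4 * lam) by rewrite divr_ge0; lra.
have /andP[mle mgt] := truncn_itv x0.
have lam_m : lam * m%:R <= 1 / 4.
  have := ler_wpM2l (ltW lam0) mle; rewrite -/m.
  by rewrite (_ : lam * (1 / (4 * lam)) = 1 / 4)//; field; rewrite gt_eqF.
have lam_m8 : 1 <= 8 * lam * m%:R.
  have : lam * (1 / (4 * lam)) < lam * m.+1%:R by rewrite ltr_pM2l.
  rewrite -(natr1 m) (_ : lam * (1 / (4 * lam)) = 1 / 4); first lra.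
  by field; rewrite gt_eqF.
have m0 : (0 < m)%N by case: (m) lam_m8 => //; lra.
have mR0 : 0 < m%:R :> R by rewrite ltr0n.
apply: le_trans (pr_sum_ge_le A lam t n m hA (ltW lam0) m0 lam_m) _.
rewrite ler_pM2l// ler_expR; set K := (n %/ m.*2).+1.
have Km : K%:R * m%:R <= n%:R / 2 + m%:R :> R.
  have : (K * m.*2 <= n + m.*2)%N by rewrite /K mulSn addnC leq_add2r leq_trunc_div.
  by rewrite -(ler_nat R) natrD natrM -mul2n natrM; lra.
have lamt : 16 * L <= lam * t.
  rewrite -ler_sqr ?nnegrE; [|lra|by rewrite mulr_ge0// ltW].
  rewrite [leRHS]exprMn; have := ler_wpM2l (sqr_ge0 lam) tL.
  apply: le_trans; rewrite [leRHS](_ : _ = 16 * L * (n%:R * lam ^+ 2 * g)); last ring.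
  by rewrite nlam2 expr2.
have ph0 := phi_ge0 P X m.
(* Combines [phi m <= Phi^2 / m^2] with [1 / m <= 8 lam]. *)
have ph : phi m <= 64 * lam ^+ 2 * Phi ^+ 2.
  apply: (@le_trans _ _ (64 * lam ^+ 2 * (m%:R ^+ 2 * phi m))).
    rewrite mulrA ler_peMl// (_ : 64 * _ * _ = (8 * lam * m%:R) ^+ 2); last ring.
    by rewrite expr_ge1//; lra.
  by apply: ler_wpM2l; [have := sqr_ge0 lam; lra|exact: phi_sqr_le].
have Kle : K%:R <= 4 * lam * n%:R + 2.
  apply: (@le_trans _ _ (K%:R * (8 * lam * m%:R))); first by rewrite ler_peMr.
  have := ler_wpM2l (ltW lam0) Km; lra.
have K1 : K%:R * (lam ^+ 2 * m%:R * (1 / 2 + 2 * Phi)) <= 4 * L + lam * g / 8.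
  have h : 0 <= lam ^+ 2 * (g / 2) by rewrite mulr_ge0 ?sqr_ge0//; lra.
  have := ler_wpM2r h Km; have := ler_wpM2r (ltW (mulr_gt0 lam0 g0)) lam_m.
  nra.
(* [64 * 132 = 512 * 16 + 256], from [n lam^2 <= 16 L] and [lam <= L]. *)
have K2 : K%:R * (2 * phi m) <= 64 * 132 * Phi ^+ 2 * lam * L.
  apply: (@le_trans _ _ ((4 * lam * n%:R + 2) * (2 * (64 * lam ^+ 2 * Phi ^+ 2)))).
    by apply: ler_pM => //; [lra|rewrite ler_pM2l].
  rewrite [leLHS](_ : _ = 512 * Phi ^+ 2 * lam * (n%:R * lam ^+ 2) +
    256 * Phi ^+ 2 * lam * lam); last ring.
  have nl : n%:R * lam ^+ 2 <= 16 * L.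
    have h : 0 <= n%:R * lam ^+ 2 by rewrite mulr_ge0 ?sqr_ge0// ltW.
    by rewrite -nlam2 ler_peMr//; lra.
  have c0 : 0 <= Phi ^+ 2 * lam by rewrite mulr_ge0// ltW.
  have := ler_wpM2l c0 nl; have : Phi ^+ 2 * lam * lam <= Phi ^+ 2 * lam * L.
    by rewrite ler_wpM2l//; lra.
  lra.
have K3 : lam * C * L <= 1 * L by rewrite ler_wpM2r//; [lra|have := lamC; lra].
have K4 : lam * g / 8 <= lam * g * L.
  have : lam * g * 1 <= lam * g * L by rewrite ler_wpM2l ?mulr_ge0//; lra.
  by have := mulr_gt0 lam0 g0; lra.
move: K3; rewrite /C mulrDr; lra.
Qed.

End deviation.

(** * Interpolation between grid points by monotonicity *)

Section monotone_interpolation.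
Context {R : realType}.
Implicit Types (F G u : R -> R).

Lemma nat_grid_bracket (u : nat -> R) n x : u 0%N <= x <= u n.+1 ->
  exists2 j, (j <= n)%N & u j <= x <= u j.+1.
Proof.
elim: n => [|n ih] /andP[ux xu]; first by exists 0%N => //; rewrite ux.
have [xn|xn] := leP x (u n.+1); last by exists n.+1; rewrite ?xu ?ltW.
by have [|j jn uj] := ih; [rewrite ux|exists j => //; exact: leqW].
Qed.

(** On a cell, [G x - F x] lies between [G (u j) - F (u j.+1)] and [G (u j.+1) - F (u j)]; each
    differs from a grid deviation by one increment of [F]. *)
Lemma monotone_grid_dist_le F G (u : nat -> R) n (e D x : R) :
  {homo F : y z / y <= z} -> {homo G : y z / y <= z} ->
  (forall j, (j <= n)%N -> F (u j.+1) - F (u j) <= D) ->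
  (forall j, (j <= n.+1)%N -> `|G (u j) - F (u j)| <= e) ->
  u 0%N <= x <= u n.+1 -> `|G x - F x| <= e + D.
Proof.
move=> Fm Gm FD GF /nat_grid_bracket[j jn /andP[ux xu]].
have := GF j (leqW jn); have := GF j.+1 jn; rewrite !ler_norml => /andP[_ h1] /andP[h2 _].
have := FD j jn; have := Fm _ _ ux; have := Fm _ _ xu.
have := Gm _ _ ux; have := Gm _ _ xu => h3 h4 h5 h6 h7.
by apply/andP; split; lra.
Qed.

End monotone_interpolation.

(** * Borel-Cantelli for probabilities of order [n^-2] *)

Section borel_cantelli_inverse_squares.
Context {d : measure_display} {T : measurableType d} {R : realType}.
Variable P : probability T R.

(** The subtracted term makes the induction telescope; the summand at [n = 0] vanishes because
    [0^-1 = 0]. *)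
Lemma sum_inv_sqr_le (c : R) N : 0 <= c ->
  \sum_(0 <= n < N.+1) (c * (n%:R ^+ 2)^-1) <= 2 * c - 2 * c / N.+1%:R.
Proof.
move=> c0; elim: N => [|N ih].
  by rewrite big_nat1 expr0n/= invr0 mulr0 divr1 subrr.
rewrite big_nat_recr//=; apply: le_trans (lerD ih (lexx _)) _.
set y : R := N.+1%:R; have y1 : 1 <= y by rewrite ler1n.
have -> : N.+2%:R = y + 1 :> R by rewrite /y natr1.
have -> : 2 * c - 2 * c / y + c * (y ^+ 2)^-1 =
    2 * c - 2 * c / (y + 1) - c * ((y - 1) / (y ^+ 2 * (y + 1))).
  by field; apply/andP; split; rewrite gt_eqF//; lra.
rewrite gerBl mulr_ge0// divr_ge0 ?mulr_ge0 ?sqr_ge0//; lra.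
Qed.

Lemma ae_eventually_not (B : nat -> set T) (c : R) n0 : 0 <= c ->
  (forall n, measurable (B n)) ->
  (forall n, (n0 <= n)%N -> pr P (B n) <= c * (n%:R ^+ 2)^-1) ->
  {ae P, forall w, \forall n \near \oo, ~ B n w}.
Proof.
(* Emptying the events before [n0] extends the bound to every index and leaves the upper limit of
   the events unchanged. *)
move=> c0 mB Bc; pose B' n := if (n0 <= n)%N then B n else set0.
have mB' n : measurable (B' n) by rewrite /B'; case: ifP.
have B'c n : (P (B' n) <= (c * (n%:R ^+ 2)^-1)%:E)%E.
  rewrite /B'; case: ifP => [/Bc|_]; first by rewrite -lee_fin EFin_pr.
  by rewrite measure0 lee_fin mulr_ge0// invr_ge0 sqr_ge0.
exists (lim_sup_set B'); split.
- apply: bigcap_measurable => // k _; exact: bigcup_measurable.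
- apply: lim_sup_set_cvg0 => //; apply: (@le_lt_trans _ _ (2 * c)%:E); last by rewrite ltry.
  apply: lime_le; first exact: is_cvg_nneseries.
  apply: nearW => -[|N]; first by rewrite big_geq// lee_fin mulr_ge0.
  apply: (@le_trans _ _ (\sum_(0 <= n < N.+1) (c * (n%:R ^+ 2)^-1))%:E).
    by rewrite -sumEFin; apply: lee_sum => n _; exact: B'c.
  rewrite lee_fin (le_trans (sum_inv_sqr_le c N c0))// gerBl divr_ge0//.
  by rewrite mulr_ge0.
move=> w nw k _; apply: contrapT => nB; apply: nw; exists (maxn n0 k) => // n /=.
rewrite geq_max => /andP[n0n kn] Bn; apply: nB; exists n => //.
by rewrite /B' n0n.
Qed.

End borel_cantelli_inverse_squares.

(** * Pointwise deviation of the empirical distribution function *)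

Section empirical_distribution.
Context {d : measure_display} {T : measurableType d} {R : realType}.
Variables (P : probability T R) (X : nat -> {RV P >-> R}) (F : R -> R).
Local Notation X' := (fun i => X i : T -> R).
Hypothesis sum_phi :
  (\sum_(1 <= n <oo) (Num.sqrt (phi_coef P X' n))%:E < +oo)%E.
Hypothesis dfX : forall i, (1 <= i)%N -> forall x, F x = fine (P [set w | X i w <= x]).
Local Notation g := (1 + 4 * sum_sqrt_phi P X).

Let le_event x i : set T := [set w | X i w <= x].

Let le_eventE x i : le_event x i = X i @^-1` `]-oo, x].
Proof. by apply/seteqP; split => w /=; rewrite in_itv. Qed.

Let le_event_gen x i (I : set nat) : I i -> gen_sigma X' I (le_event x i).
Proof. by move=> Ii; rewrite le_eventE; exact: (@gen_sigma_preimage _ _ _ P X). Qed.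

Let le_eventC_gen x i (I : set nat) : I i -> gen_sigma X' I (~` le_event x i).
Proof.
by move=> Ii; rewrite le_eventE preimage_setC; apply: (@gen_sigma_preimage _ _ _ P X) => //;
  exact: measurableC.
Qed.

Let measurable_le_event x i : measurable (le_event x i).
Proof. by apply: (@gen_sigma_measurable _ _ _ P X [set i]); exact: le_event_gen. Qed.

Lemma df_homo : {homo F : x y / x <= y}.
Proof.
move=> x y xy; rewrite !(dfX 1)//; apply: le_pr; [exact: measurable_le_event..|].
by move=> w /= /le_trans; apply.
Qed.

Lemma emp_df_homo n w : {homo emp_df X' n w : x y / x <= y}.
Proof.
move=> x y xy; rewrite /emp_df ler_wpM2l ?invr_ge0//.
apply: ler_sum => i _; rewrite ler_nat.
by case: (X i w <= x) / boolP => // /le_trans/(_ xy) ->.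
Qed.

Let emp_df_sub n w x : (0 < n)%N ->
  n%:R * (emp_df X' n w x - F x) = \sum_(1 <= i < n.+1) centered P (le_event x) i w.
Proof.
move=> n0; rewrite /emp_df mulrBr mulrA divff ?pnatr_eq0 -?lt0n// mul1r.
rewrite [n%:R * F x](_ : _ = \sum_(1 <= i < n.+1) F x); last first.
  by rewrite sumr_const_nat subn1 mulr_natl.
rewrite -sumrB big_nat [RHS]big_nat; apply: eq_bigr => i /andP[i1 _].
rewrite /centered (dfX i)// indicE; congr (_%:R - _).
by congr nat_of_bool; apply/idP/idP; rewrite inE.
Qed.

(** Complements turn a lower deviation into an upper one, so the one-sided bound serves both
    tails. *)
Let sub_emp_df n w x : (0 < n)%N ->
  n%:R * (F x - emp_df X' n w x) =
  \sum_(1 <= i < n.+1) centered P (fun i => ~` le_event x i) i w.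
Proof.
move=> n0; rewrite -opprB mulrN emp_df_sub// -sumrN; apply: eq_bigr => i _.
by rewrite /centered prC// !indicE in_setC; case: (w \in _) => /=; lra.
Qed.

Lemma measurable_emp_df_dev n (e x : R) :
  measurable [set w | e <= `|emp_df X' n w x - F x|].
Proof.
have bG : bounded_mfun (fun w => emp_df X' n w x - F x).
  apply: bounded_mfunD; last exact: bounded_mfun_cst.
  apply: bounded_mfunM; first exact: bounded_mfun_cst.
  apply: bounded_mfun_sum => i.
  rewrite (_ : (fun w => _) = \1_(le_event x i)); first exact: bounded_mfun_indic.
  apply/funext => w; rewrite indicE; congr (_%:R); congr nat_of_bool.
  by apply/idP/idP; rewrite inE.
have bN : bounded_mfun (fun w => -1 * (emp_df X' n w x - F x)).
  by apply: bounded_mfunM => //; exact: bounded_mfun_cst.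
rewrite (_ : [set w | _] = [set w | e <= emp_df X' n w x - F x] `|`
    [set w | e <= -1 * (emp_df X' n w x - F x)]).
  by apply: measurableU; exact: bounded_mfun_measurable_ge.
apply/seteqP; split => w /=; rewrite ler_normr mulN1r; first by move/orP.
by move=> h; apply/orP.
Qed.

(** The factor 4 is two tails times the factor 2 of the one-sided bound. *)
Lemma eventually_pr_emp_df_dev_le : exists2 c : R, 1 <= c & forall n (e x : R),
  c <= ln n%:R -> 0 <= e -> 16 * g * ln n%:R <= n%:R * e ^+ 2 ->
  pr P [set w | e <= `|emp_df X' n w x - F x|] <= 4 * (n%:R ^+ 3)^-1.
Proof.
have [c c1 hc] := eventually_pr_sum_ge_le P X sum_phi.
exists c => // n e x cn e0 ne.
have n0 : (0 < n)%N by apply: ln_natr_ge_gt0 (lt_le_trans ltr01 c1) cn.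
have nR0 : 0 < n%:R :> R by rewrite ltr0n.
have t0 : 0 <= n%:R * e by rewrite mulr_ge0.
have tL : 16 * g * n%:R * ln n%:R <= (n%:R * e) ^+ 2.
  have := ler_wpM2l (ltW nR0) ne; rewrite exprMn; lra.
have E3 : expR (- (3 * ln n%:R)) = (n%:R ^+ 3)^-1 :> R.
  by rewrite expRN expRM_natl lnK.
have h1 := hc n _ _ (@le_event_gen x) cn t0 tL.
have h2 := hc n _ _ (@le_eventC_gen x) cn t0 tL.
move: h1 h2; rewrite E3 => h1 h2.
set B1 := [set w | _] in h1; set B2 := [set w | _] in h2.
have mB (A : nat -> set T) : (forall i, measurable (A i)) ->
    measurable [set w | n%:R * e <= \sum_(1 <= i < n.+1) centered P A i w].
  move=> mA; apply: bounded_mfun_measurable_ge; apply: bounded_mfun_sum => i.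
  apply: bounded_mfunD; last exact: bounded_mfun_cst.
  exact: bounded_mfun_indic.
have m1 : measurable B1 by apply: mB => i; exact: measurable_le_event.
have m2 : measurable B2 by apply: mB => i; apply: measurableC; exact: measurable_le_event.
apply: (@le_trans _ _ (pr P (B1 `|` B2))); last first.
  by apply: le_trans (prU_le P _ _ m1 m2) _; lra.
apply: le_pr; [exact: measurable_emp_df_dev|exact: measurableU|].
move=> w /=; rewrite ler_normr => /orP[h|h]; [left|right]; rewrite /B1 /B2/=.
  by rewrite -emp_df_sub// ler_wpM2l.
by rewrite -sub_emp_df// ler_wpM2l// -opprB.
Qed.

End empirical_distribution.

(** * Lipschitz bound on the distribution function from its density *)

Lemma df_increment_le {R : realType} (F f : R -> R) (N : set R) (x y : R) :
  {within N, continuous f} -> (forall t, N t -> 0 < f t) ->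
  (forall x y, x <= y -> `[x, y] `<=` N ->
     (\int[lebesgue_measure]_(t in `[x, y]) (f t)%:E = (F y - F x)%:E)%E) ->
  has_ubound (f @` N) -> x <= y -> `[x, y] `<=` N ->
  F y - F x <= sup (f @` N) * (y - x).
Proof.
move=> cf f0 Ff ubf xy xyN.
have mf : measurable_fun `[x, y] f.
  apply: subspace_continuous_measurable_fun => //.
  exact: continuous_subspaceW cf.
rewrite -lee_fin -Ff//.
apply: (@le_trans _ _ (\int[lebesgue_measure]_(t in `[x, y]) (cst (sup (f @` N))%:E) t)%E).
  apply: ge0_le_integral => //=.
  - by move=> t /xyN/f0/ltW; rewrite lee_fin.
  - exact/measurable_EFinP.
  - move=> t xyt; rewrite lee_fin; apply: ub_le_sup => //.
    by exists t => //; exact: xyN.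
rewrite integral_cst//= lebesgue_measure_itv/= lte_fin.
case: ltP => [_|yx]; first by rewrite -EFinD -EFinM.
by rewrite mule0 lee_fin (_ : y - x = 0) ?mulr0//; apply/eqP; rewrite subr_eq0 eq_le xy yx.
Qed.

(** * Asymptotics of the radii *)

Section rates.
Context {R : realType}.
Implicit Types (a r : R).

(** For [a = 16 C_3 + theta], the bound of the theorem without its factor [1 + d]. *)
Definition dev_radius a n : R := Num.sqrt (a * ln n%:R / (4 * n%:R)).

(** For the same [a], the half-width [tau_n] of the interval. *)
Definition nbhd_radius a n : R := Num.sqrt a * (ln n%:R `^ (3 / 2)) /
  (Num.sqrt n%:R * Num.sqrt (ln (ln n%:R))).

Lemma eventually_ln_ge (c : R) : exists n0, forall n, (n0 <= n)%N -> c <= ln (n%:R : R).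
Proof.
exists (Num.truncn (expR c)).+1 => n cn.
have /andP[_ h] := truncn_itv (expR_ge0 c).
have cn' : expR c <= n%:R by rewrite (le_trans (ltW h))// ler_nat.
rewrite -[leLHS]expRK ler_ln// posrE ?expR_gt0//.
exact: lt_le_trans (expR_gt0 c) cn'.
Qed.

Lemma nbhd_radius_ge0 a n : 0 <= nbhd_radius a n.
Proof. by rewrite divr_ge0 ?mulr_ge0 ?powR_ge0 ?sqrtr_ge0. Qed.

Lemma nbhd_radius_sqr_le a n : 0 <= a -> (0 < n)%N -> expR 1 <= ln (n%:R : R) ->
  nbhd_radius a n ^+ 2 <= a * ln n%:R ^+ 3 / n%:R.
Proof.
move=> a0 n0 L1; have e1 := expR_ge1Dx (1 : R).
set L : R := ln n%:R in L1 *.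
have nR0 : 0 < n%:R :> R by rewrite ltr0n.
have L0 : 0 < L by lra.
have LL : 1 <= ln L by rewrite -[leLHS]expRK ler_ln ?posrE ?expR_gt0.
rewrite /nbhd_radius -/L !exprMn exprVn exprMn !sqr_sqrtr//; [|lra].
have -> : (L `^ (3 / 2)) ^+ 2 = L ^+ 3.
  by rewrite -powR_mulrn ?powR_ge0// -powRrM (_ : 3 / 2 * 2%:R = 3%:R) ?powR_mulrn//;
    [exact: ltW|lra].
apply: ler_wpM2l; first by rewrite mulr_ge0// exprn_ge0// ltW.
by rewrite lef_pV2 ?posrE ?mulr_gt0//; [rewrite ler_peMr|]; lra.
Qed.

(** The first bound keeps the interval inside the neighborhood; the second makes the mesh
    [2 tau_n / n] at most the deviation radius. *)
Lemma eventually_nbhd_radius_le a r : 0 < a -> 0 < r ->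
  exists c, forall n, c <= ln (n%:R : R) ->
    nbhd_radius a n < r /\ 2 * nbhd_radius a n <= n%:R * dev_radius a n.
Proof.
(* [expR 1] ensures [ln (ln n) >= 1]; 5 gives [4 L <= n] through [125 L <= L^4 <= 24 n]; the last
   term gives [a L^3 / n <= 24 a / L < r^2]. *)
move=> a0 r0; exists (expR 1 + 5 + 24 * a / r ^+ 2) => n.
set L : R := ln n%:R => cL.
have h0 : 0 <= 24 * a / r ^+ 2 by rewrite divr_ge0 ?sqr_ge0//; lra.
have e0 := expR_gt0 (1 : R).
have L5 : 5 <= L by lra.
have n0 : (0 < n)%N by apply: (@ln_natr_ge_gt0 R 5).
have nR0 : 0 < n%:R :> R by rewrite ltr0n.
have L4 : L ^+ 4 <= 24 * n%:R by apply: ln_pow4_le => //; rewrite -/L; lra.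
have tau2 := @nbhd_radius_sqr_le a n (ltW a0) n0; rewrite -/L in tau2.
have {}tau2 : nbhd_radius a n ^+ 2 <= a * L ^+ 3 / n%:R by apply: tau2; lra.
have tau0 := nbhd_radius_ge0 a n.
split.
  rewrite -ltr_sqr ?nnegrE ?(ltW r0)//; apply: le_lt_trans tau2 _.
  rewrite ltr_pdivrMr//.
  have aL : 24 * a < L * r ^+ 2 by rewrite -ltr_pdivrMr ?exprn_gt0//; lra.
  have L30 : 0 < L ^+ 3 by rewrite exprn_gt0//; lra.
  have h1 : 24 * a * L ^+ 3 < L * r ^+ 2 * L ^+ 3 by rewrite ltr_pM2r.
  have h2 : r ^+ 2 * L ^+ 4 <= r ^+ 2 * (24 * n%:R) by rewrite ler_wpM2l ?sqr_ge0.
  have h3 : L * r ^+ 2 * L ^+ 3 = r ^+ 2 * L ^+ 4 by ring.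
  lra.
have L_n : 4 * L <= n%:R.
  have L3 : 5 ^+ 3 <= L ^+ 3 by rewrite lerXn2r ?nnegrE; lra.
  have L0 : 0 <= L by lra.
  have := ler_wpM2r L0 L3; rewrite (_ : L ^+ 3 * L = L ^+ 4); last ring.
  lra.
have d2 : dev_radius a n ^+ 2 = a * L / (4 * n%:R).
  by rewrite sqr_sqrtr// -/L divr_ge0 ?mulr_ge0//; lra.
have dev0 : 0 <= dev_radius a n by exact: sqrtr_ge0.
move: (nbhd_radius a n) (dev_radius a n) tau0 tau2 dev0 d2 => s e s0 s2 dev0 d2.
rewrite -ler_sqr ?nnegrE ?mulr_ge0 ?(ltW nR0)// !exprMn d2.
apply: (@le_trans _ _ (2 ^+ 2 * (a * L ^+ 3 / n%:R))).
  by rewrite ler_pM2l ?exprn_gt0.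
rewrite -(@ler_pM2r _ (4 * n%:R)) ?mulr_gt0//.
rewrite [leLHS](_ : _ = a * L * (4 * L) ^+ 2); last by field; rewrite gt_eqF.
rewrite [leRHS](_ : _ = a * L * n%:R ^+ 2); last by field; rewrite gt_eqF.
apply: ler_wpM2l; first by rewrite mulr_ge0; lra.
by rewrite ler_sqr ?nnegrE; lra.
Qed.

End rates.

(** * Union bound over the grid and conclusion *)

Theorem theorem2p4 (d0 : measure_display) (T : measurableType d0) (R : realType)
  (P : probability T R) (X : nat -> {RV P >-> R}) (F : R -> R)
  (p : R) (N : set R) (f : R -> R) :
  (* phi-mixing *)
  phi_coef P (fun i => X i) n @[n --> \oo] --> 0 ->
  (* sum_{n>=1} phi^{1/2}(n) < oo *)
  (\sum_(1 <= n <oo) (Num.sqrt (phi_coef P (fun i => X i) n))%:E < +oo)%E ->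
  (* common marginal distribution function F *)
  (forall i : nat, (1 <= i)%N -> forall x : R,
      F x = fine (P [set w | X i w <= x])) ->
  0 < p < 1 ->
  let xi := inf [set x | p <= F x] in
  (* F has a positive continuous density f on a neighborhood N of xi_p *)
  nbhs xi N ->
  {within N, continuous f} ->
  (forall x, N x -> 0 < f x) ->
  (forall x y, x <= y -> `[x, y] `<=` N ->
     (\int[lebesgue_measure]_(t in `[x, y]) (f t)%:E = (F y - F x)%:E)%E) ->
  (* d = sup f(N) < oo *)
  has_ubound (f @` N) ->
  let dd := sup (f @` N) in
  let C3 := 4 * (1 + 4 * fine (\sum_(1 <= n <oo)
                   (Num.sqrt (phi_coef P (fun i => X i) n))%:E)%E) in
  forall theta : R, 0 < theta ->
  let tau := fun n : nat =>
    Num.sqrt (16 * C3 + theta) * (ln n%:R `^ (3 / 2))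
      / (Num.sqrt n%:R * Num.sqrt (ln (ln n%:R))) in
  {ae P, forall w, \forall n \near \oo,
     sup [set `| emp_df (fun i => X i) n w x - F x | | x in `[xi - tau n, xi + tau n]]
       <= (1 + dd) * Num.sqrt ((16 * C3 + theta) * ln n%:R / (4 * n%:R))}.
Proof.
move=> _ sum_phi dfX _ xi Nxi cf f0 Ff ubf dd C3 theta theta0 tau.
set a : R := 16 * C3 + theta.
have Phi0 := sum_sqrt_phi_ge0 P X sum_phi.
have C3E : C3 = 4 * (1 + 4 * sum_sqrt_phi P X) by [].
have a0 : 0 < a by rewrite /a C3E; lra.
have [r r0 rN] : exists2 r : R, 0 < r & forall x, `|x - xi| < r -> N x.
  have /nbhs_ballP[r r0 rN] := Nxi; exists r => // x xr; apply: rN.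
  by rewrite /ball/= distrC.
have [c1 c11 hdev] := eventually_pr_emp_df_dev_le P X F sum_phi dfX.
have [c2 hrad] := eventually_nbhd_radius_le a r a0 r0.
have [n1 hn1] := eventually_ln_ge c1; have [n2 hn2] := eventually_ln_ge c2.
(* The points [j = 0, ..., n] cut the interval into [n] cells; [B n] is the event of a large
   deviation at one of them. *)
pose u n j : R := xi - tau n + (2 * tau n / n%:R) * j%:R.
pose dev n j := [set w | dev_radius a n <= `|emp_df (fun i => X i) n w (u n j) - F (u n j)|].
pose B n := \big[setU/set0]_(j < n.+1) dev n j.
have mdev n j : measurable (dev n j) by exact: (@measurable_emp_df_dev _ _ _ P X F).
have mB n : measurable (B n) by apply: bigsetU_measurable => j _; exact: mdev.
have n_gt0 n : (n1 <= n)%N -> (0 < n)%N.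
  by move/hn1; apply: ln_natr_ge_gt0; exact: lt_le_trans ltr01 c11.
have prB n : (n1 <= n)%N -> pr P (B n) <= 8 * (n%:R ^+ 2)^-1.
  move=> n1n; have n0 := n_gt0 n n1n; have c1n := hn1 n n1n.
  have nR1 : 1 <= n%:R :> R by rewrite ler1n.
  have d2 : dev_radius a n ^+ 2 = a * ln n%:R / (4 * n%:R).
    by rewrite sqr_sqrtr// divr_ge0 ?mulr_ge0//; lra.
  have hj j : pr P (dev n j) <= 4 * (n%:R ^+ 3)^-1.
    apply: hdev => //; first exact: sqrtr_ge0.
    (* Since [a = 64 g + theta], the quarter [a / 4] exceeds the required [16 g]. *)
    rewrite d2 [leRHS](_ : _ = a / 4 * ln n%:R); last by field; rewrite gt_eqF//; lra.
    by apply: ler_wpM2r; [lra|rewrite /a C3E; lra].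
  apply: (@le_trans _ _ (n.+1%:R * (4 * (n%:R ^+ 3)^-1))).
    rewrite -lee_fin EFin_pr//.
    apply: le_trans (Boole_inequality P (A := dev n) (fun j _ => mdev n j)) _.
    apply: (@le_trans _ _ (\sum_(j < n.+1) (4 * (n%:R ^+ 3)^-1)%:E)%E).
      by apply: lee_sum => j _; have := hj j; rewrite -lee_fin EFin_pr.
    by rewrite sumEFin sumr_const card_ord -(mulr_natl (4 * (n%:R ^+ 3)^-1) n.+1).
  have nR0 : 0 < n%:R :> R by rewrite ltr0n.
  rewrite -(natr1 n).
  rewrite -(@ler_pM2r _ (n%:R ^+ 3)) ?exprn_gt0//.
  rewrite [leLHS](_ : _ = 4 * (n%:R + 1)); last by field; rewrite gt_eqF.
  rewrite [leRHS](_ : _ = 8 * n%:R); last by field; rewrite gt_eqF.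
  lra.
have := ae_eventually_not P B 8 n1 (ler0n _ 8) mB prB.
apply: filterS => w [n3 _ hw]; exists (maxn n1 (maxn n2 n3)) => // n /=.
rewrite !geq_max => /and3P[n1n n2n n3n].
have n0 := n_gt0 n n1n; have nR0 : 0 < n%:R :> R by rewrite ltr0n.
have [tau_r tau_dev] : tau n < r /\ 2 * tau n <= n%:R * dev_radius a n.
  by apply: hrad; exact: hn2.
rewrite -/(dev_radius a n).
have tau0 : 0 <= tau n := nbhd_radius_ge0 a n.
have dd0 : 0 <= dd.
  have Nx : N xi by apply: rN; rewrite subrr normr0.
  by apply: (@le_trans _ _ (f xi)); [exact/ltW/f0|apply: ub_le_sup => //; exists xi].
have un : u n n = xi + tau n by rewrite /u; field; rewrite gt_eqF.
have u0 : u n 0%N = xi - tau n by rewrite /u mulr0 addr0.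
have step0 : 0 <= 2 * tau n / n%:R by apply: divr_ge0; [lra|exact: ltW].
have u_le i j : (i <= j)%N -> u n i <= u n j.
  by move=> ij; rewrite lerD2l ler_wpM2l// ler_nat.
apply: ge_sup; first by exists `|emp_df (fun i => X i) n w xi - F xi|, xi => //=;
  rewrite in_itv/=; apply/andP; split; lra.
move=> _ [x /= xE <-]; rewrite mulrDl mul1r.
have {}un : u n n.-1.+1 = xi + tau n by rewrite prednK.
(* The lemma counts one cell more than its argument, hence [n.-1] for [n] cells. *)
apply: (@monotone_grid_dist_le _ F _ (u n) n.-1).
- exact: (@df_homo _ _ _ P X F dfX).
- exact: emp_df_homo.
(* An increment over a cell is at most [dd] times the mesh, hence [dd] times the radius. *)
- move=> j jn; apply: (@le_trans _ _ (dd * (u n j.+1 - u n j))).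
    apply: (@df_increment_le _ F f N) => //; first exact: u_le.
    move=> y /=; rewrite in_itv/= => /andP[jy yj]; apply: rN.
    have := u_le 0%N j isT; have : (j.+1 <= n.-1.+1)%N by [].
    by move=> /u_le; rewrite u0 un ltr_norml => ? ?; apply/andP; split; lra.
  apply: ler_wpM2l => //; rewrite /u.
  rewrite [leLHS](_ : _ = 2 * tau n / n%:R); last by rewrite -(natr1 j); ring.
  by rewrite ler_pdivrMr// [leRHS]mulrC.
(* Outside [B n] every grid deviation is below the radius. *)
- move=> j; rewrite prednK// => jn; rewrite leNgt; apply/negP => /ltW devj.
  apply: (hw n n3n); rewrite /B -bigcup_mkord; exists j => //=.
- by rewrite u0 un; move: xE; rewrite in_itv.
Qed.
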